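(* Let $n\ge 2$ and let $f:\mathcal{U}_n\to\mathbb{R}$ be a cost function of the form (I) or (II) described in the context. Let $L\ge 0$ be a constant such that $$\left|f(U\exp(\Omega))-f(U)-\langle U\Omega,\operatorname{grad} f(U)\rangle_{\Re}\right|\le \frac{L}{2}\|U\Omega\|^2$$ for all $U\in\mathcal{U}_n$ and all skew-Hermitian $\Omega\in\mathbb{C}^{n\times n}$. Let $f^*=\max_{U\in\mathcal{U}_n}f(U)$, and let $U_0,U_1,U_2,\dots$ be any sequence of iterations of the Jacobi-G algorithm (see context) with constant $\delta\in(0,\sqrt2/n]$. Then: (i) $\|\operatorname{grad} f(U_k)\|\to 0$ as $k\to\infty$; in particular, every accumulation point of $(U_k)$ is a stationary point of $f$. (ii) For every $\varepsilon>0$, the algorithm needs at most $$\left\lceil \frac{2L\,(f^*-f(U_0))}{\delta^2}\,\frac{1}{\varepsilon^2}\right\rceil$$ iterations to reach an $\varepsilon$-optimal solution, i.e. there is an index $k$ not exceeding this number with $\|\operatorname{grad} f(U_k)\|\le\varepsilon$.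
   Context: $\mathcal{U}_n\subset\mathbb{C}^{n\times n}$ is the unitary group, regarded as a real Riemannian submanifold of $\mathbb{C}^{n\times n}$ with the real inner product $\langle X,Y\rangle_{\Re}=\Re(\operatorname{tr}(X^{\mathsf H}Y))$; $\operatorname{grad} f$ is the Riemannian gradient; the tangent space at $U$ is $\{U\Omega:\Omega+\Omega^{\mathsf H}=0\}$; $\|\cdot\|$ is the Frobenius norm. A stationary point is a point where $\operatorname{grad} f=0$. Tensors. For an order-$d$ tensor (array) $\mathcal{A}\in\mathbb{C}^{n\times\cdots\times n}$ and $M\in\mathbb{C}^{m\times n}$, $(\mathcal{A}\bullet_k M)_{i_1\dots i_d}=\sum_{j=1}^n\mathcal{A}_{i_1\dots i_{k-1}\,j\,i_{k+1}\dots i_d}M_{i_k,j}$; multiple contractions are performed simultaneously. $\operatorname{diag}\{\mathcal{A}\}\in\mathbb{C}^n$ is the vector of diagonal elements $\mathcal{A}_{i\dots i}$ and $\operatorname{tr}\{\mathcal{A}\}$ is their sum. Cost functions. (I) $f(U)=\sum_{\ell=1}^{L'}\alpha_\ell\,\|\operatorname{diag}\{\mathcal{A}^{(\ell)}\bullet_1U^{\mathsf H}\cdots\bullet_{t_\ell}U^{\mathsf H}\bullet_{t_\ell+1}U^{\mathsf T}\cdots\bullet_{d_\ell}U^{\mathsf T}\}\|^2$, where $\mathcal{A}^{(\ell)}\in\mathbb{C}^{n\times\cdots\times n}$ has order $d_\ell$, $0\le t_\ell\le d_\ell$ are integers and $\alpha_\ell\in\mathbb{R}$. (II) $f(U)=\operatorname{tr}\{\mathcal{B}\bullet_1U^{\mathsf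 H}\cdots\bullet_dU^{\mathsf H}\bullet_{d+1}U^{\mathsf T}\cdots\bullet_{2d}U^{\mathsf T}\}$, where $\mathcal{B}\in\mathbb{C}^{n\times\cdots\times n}$ has order $2d$ and is Hermitian: $\mathcal{B}_{i_1\cdots i_dj_1\cdots j_d}=\mathcal{B}^*_{j_1\cdots j_di_1\cdots i_d}$ ($^*$ denotes complex conjugation). Plane transformations. For $1\le i<j\le n$ and $\Psi\in\mathcal{U}_2$, $G^{(i,j,\Psi)}\in\mathcal{U}_n$ is the matrix that coincides with $I_n$ except that its entries at $(i,i),(i,j),(j,i),(j,j)$ are $\Psi_{11},\Psi_{12},\Psi_{21},\Psi_{22}$. For $U\in\mathcal{U}_n$ define $h_{(i,j),U}:\mathcal{U}_2\to\mathbb{R}$, $h_{(i,j),U}(\Psi)=f(UG^{(i,j,\Psi)})$. Jacobi-G algorithm. Input: a starting point $U_0\in\mathcal{U}_n$ and a constant $0<\delta\le\sqrt2/n$. For $k=1,2,\dots$: choose a pair $(i_k,j_k)$, $i_k<j_k$, with $\|\operatorname{grad}h_{(i_k,j_k),U_{k-1}}(I_2)\|\ge\delta\|\operatorname{grad}f(U_{k-1})\|$ (such a pair always exists); find a maximizer $\Psi_k\in\mathcal{U}_2$ of $h_{(i_k,j_k),U_{k-1}}$; set $U_k=U_{k-1}G^{(i_k,j_k,\Psi_k)}$. *)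

(* Defs.v *)
From HB Require Import structures.
From mathcomp Require Import all_boot all_order all_algebra.
From mathcomp Require Import all_classical all_reals all_analysis.
From mathcomp Require Import complex.

Set Implicit Arguments.
Unset Strict Implicit.
Unset Printing Implicit Defensive.

Import Order.TTheory GRing.Theory Num.Theory numFieldNormedType.Exports.

Local Open Scope classical_set_scope.
Local Open Scope ring_scope.
Local Open Scope complex_scope.
Local Open Scope sesquilinear_scope.

(* [R[i]] itself carries no topology in the library. Its [numClosedFieldType]
   structure does (through [numFieldNormedType.Exports]), and matrices over it
   then get the usual topology of C^(m x n). *)
Definition Cplx (R : realType) : numClosedFieldType := R[i].

Section Frobenius.
Context {R : realType}.
Local Notation C := (Cplx R).

(* <X, Y>_Re = Re tr(X^H Y); [X^t*] is the conjugate transpose X^H. *)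
Definition reinner m n (X Y : 'M[C]_(m, n)) : R := complex.Re (\tr (X^t* *m Y)).

Definition frob m n (X : 'M[C]_(m, n)) : R := Num.sqrt (reinner X X).

End Frobenius.

Section UnitaryGroup.
Context {R : realType}.
Local Notation C := (Cplx R).
Implicit Types n : nat.

Definition skew_hermitian n (Omega : 'M[C]_n) : Prop := Omega + Omega^t* = 0.

Definition expmx n (A : 'M[C]_n) : 'M[C]_n :=
  lim (series (fun k => (k`!%:R : C)^-1 *: A ^+ k) @ \oo).

(* gamma : R -> C^(n x n) is differentiable at 0 (as a map between real vector
   spaces) with gamma'(0) = Z. *)
Definition has_velocity0 n (gamma : R -> 'M[C]_n) (Z : 'M[C]_n) : Prop :=
  forall a b,
    is_derive (0 : R) (1 : R) (fun s => complex.Re (gamma s a b))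
      (complex.Re (Z a b)) /\
    is_derive (0 : R) (1 : R) (fun s => complex.Im (gamma s a b))
      (complex.Im (Z a b)).

(* G is the Riemannian gradient at U of the restriction of f to the unitary
   group: G is tangent at U, and it represents the differential of f, i.e.
   (f o gamma)'(0) = <G, gamma'(0)>_Re for every curve gamma in the unitary
   group through U. Only the values of f at unitary matrices matter. *)
Definition is_rgrad n (f : 'M[C]_n -> R) (U G : 'M[C]_n) : Prop :=
  (exists2 Omega, skew_hermitian Omega & G = U *m Omega) /\
  forall (gamma : R -> 'M[C]_n) (Z : 'M[C]_n),
    (forall s, gamma s \is unitarymx) -> gamma 0 = U -> has_velocity0 gamma Z ->
    is_derive (0 : R) (1 : R) (f \o gamma) (reinner G Z).

(* The default value 0 plays no role for the cost functions below: they are real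
   polynomials in the real and imaginary parts of the entries of U, so they have
   a Riemannian gradient at every unitary U. *)
Definition rgrad n (f : 'M[C]_n -> R) (U : 'M[C]_n) : 'M[C]_n :=
  xget 0 [set G | is_rgrad f U G].

Definition stationary n (f : 'M[C]_n -> R) (U : 'M[C]_n) : Prop :=
  U \is unitarymx /\ rgrad f U = 0.

Definition is_max_unitary n (f : 'M[C]_n -> R) (m : R) : Prop :=
  (exists2 U, U \is unitarymx & f U = m) /\
  (forall U, U \is unitarymx -> f U <= m).

End UnitaryGroup.

Section Tensors.
Context {R : realType}.
Local Notation C := (Cplx R).
Implicit Types n d : nat.

Definition tensor n d := d.-tuple 'I_n -> C.

(* The multi-index i with its k-th entry replaced by j. *)
Definition set_index n d (i : d.-tuple 'I_n) (k : 'I_d) (j : 'I_n) :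
    d.-tuple 'I_n :=
  [tuple if l == k then j else tnth i l | l < d].

(* A •_k M, for a square matrix M (so that the shape of A is preserved). *)
Definition contract n d (A : tensor n d) (k : 'I_d) (M : 'M[C]_n) : tensor n d :=
  fun i => \sum_(j < n) A (set_index i k j) * M (tnth i k) j.

(* A •_1 M_1 ... •_d M_d. *)
Definition contract_all n d (A : tensor n d) (M : 'I_d -> 'M[C]_n) : tensor n d :=
  foldl (fun B k => contract B k (M k)) A (enum 'I_d).

(* A •_1 U^H ... •_t U^H •_(t+1) U^T ... •_d U^T; modes are numbered from 0
   in 'I_d. *)
Definition rotate_tensor n d (A : tensor n d) (t : nat) (U : 'M[C]_n) :
    tensor n d :=
  contract_all A (fun k => if (k < t)%N then U^t* else U^T).

Definition tensor_diag n d (A : tensor n d) : 'cV[C]_n :=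
  \col_i A [tuple i | _ < d].

Definition tensor_tr n d (A : tensor n d) : C := \sum_(i < n) A [tuple i | _ < d].

Definition hermitian_tensor n d (B : tensor n (d + d)) : Prop :=
  forall i j : d.-tuple 'I_n,
    B [tuple of i ++ j] = (B [tuple of j ++ i])^*.

(* [cost_I] and [cost_II] prescribe f on the unitary group only: f stands for a
   function defined there, and its other values are irrelevant. *)
Definition cost_I n (f : 'M[C]_n -> R) : Prop :=
  exists (p : nat) (d t : 'I_p -> nat) (alpha : 'I_p -> R)
      (A : forall l : 'I_p, tensor n (d l)),
    (forall l, (t l <= d l)%N) /\
    forall U, U \is unitarymx ->
      f U = \sum_(l < p)
              alpha l * frob (tensor_diag (rotate_tensor (A l) (t l) U)) ^+ 2.

Definition cost_II n (f : 'M[C]_n -> R) : Prop :=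
  exists (d : nat) (B : tensor n (d + d)),
    hermitian_tensor B /\
    forall U, U \is unitarymx ->
      (* the trace is real because B is Hermitian *)
      (f U)%:C = tensor_tr (rotate_tensor B d U) :> C.

End Tensors.

Section Jacobi.
Context {R : realType}.
Local Notation C := (Cplx R).
Variable n : nat.

(* G^(i,j,Psi). *)
Definition plane (i j : 'I_n) (Psi : 'M[C]_2) : 'M[C]_n :=
  \matrix_(a, b)
    if (a == i) && (b == i) then Psi 0 0
    else if (a == i) && (b == j) then Psi 0 1
    else if (a == j) && (b == i) then Psi 1 0
    else if (a == j) && (b == j) then Psi 1 1
    else (a == b)%:R.

(* h_{(i,j),U}. *)
Definition plane_cost (f : 'M[C]_n -> R) (i j : 'I_n) (U : 'M[C]_n)
    (Psi : 'M[C]_2) : R :=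
  f (U *m plane i j Psi).

Definition jacobi_step (f : 'M[C]_n -> R) (delta : R) (U V : 'M[C]_n) : Prop :=
  exists (i j : 'I_n) (Psi : 'M[C]_2),
    [/\ (i < j)%N,
        frob (rgrad (plane_cost f i j U) 1%:M) >= delta * frob (rgrad f U),
        Psi \is unitarymx,
        (forall Phi : 'M[C]_2, Phi \is unitarymx ->
           plane_cost f i j U Phi <= plane_cost f i j U Psi)
      & V = U *m plane i j Psi].

Definition jacobi_G (f : 'M[C]_n -> R) (delta : R) (U : nat -> 'M[C]_n) : Prop :=
  U 0%N \is unitarymx /\ forall k, jacobi_step f delta (U k) (U k.+1).

End Jacobi.

(* Main.v *)
Require Import Defs.
From HB Require Import structures.
From mathcomp Require Import all_boot all_order all_algebra.
From mathcomp Require Import all_classical all_reals all_analysis.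
From mathcomp Require Import complex ring lra.

Set Implicit Arguments.
Unset Strict Implicit.
Unset Printing Implicit Defensive.

Import Order.TTheory GRing.Theory Num.Theory numFieldNormedType.Exports.

Local Open Scope classical_set_scope.
Local Open Scope ring_scope.
Local Open Scope sesquilinear_scope.

(** The proof is the usual sufficient-increase argument for ascent methods.
    Let U be the current iterate, (i, j) the chosen pair, and H the gradient at
    the identity of the cost restricted to plane transformations.  H is a
    2 x 2 skew-Hermitian matrix, and the (i, j) block of U^H grad f(U) (lemma
    [plane_cost_rgrad]).  The exponential of the matrix E that carries s H in
    its (i, j) block is again a plane transformation ([expmx_plane]), so
    the maximizer over all plane transformations does at least as well as
    U exp(E).  Since <U E, grad f(U)> = s |H|^2, the second-order bound on f
    gives, for every real s, an increase of at least s |H|^2 - (L/2) s^2 |H|^2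
    ([jacobi_step_gain]).  Optimizing over s yields |H|^2 <= 2 L (increase)
    ([quadratic_gain]), and the selection rule for the pair turns this into
    delta^2 |grad f(U_k)|^2 <= 2 L (f(U_(k+1)) - f(U_k)).  The increases
    telescope and f is bounded by f^*, so the squares of the gradient norms
    have bounded partial sums.  Hence the norms tend to 0, and the first
    ceil(2 L (f^* - f(U_0)) / (delta^2 eps^2)) + 1 of them cannot all exceed
    eps.

    The gradient is specified by its action on curves of unitary matrices, so
    it has to be shown to exist and to be unique.  It exists, and depends
    continuously on U, because on unitary matrices f is the real part of a
    polynomial in the entries and their conjugates: such functions form an algebra of functions with
    continuous Wirtinger derivatives ([C1fun], [cost_C1fun], [rgrad_exists]).  It
    is unique, because every tangent vector is the velocity of a curve of unitary
    matrices ([tangent_curve], [is_rgrad_unique]).  Continuity of the gradient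
    makes accumulation points stationary, because the limit of a continuous
    function along the iterates is its value at each of them
    ([cluster_seq_eq]); unitarity of these points follows in the same way
    ([unitary_cluster]).

    Curves and exponentials both come from the spectral theorem: a
    skew-Hermitian matrix is V^H diag(i theta) V with V unitary, so that its
    exponential is V^H diag(cos theta + i sin theta) V ([expmx_isometry]). *)

(** * Real and imaginary parts, and continuity of matrix-valued maps *)
Section ComplexPlane.
Context {R : realType}.
Local Notation C := (Cplx R).
Local Notation Re := (@complex.Re R).
Local Notation Im := (@complex.Im R).
Implicit Types z w : C.

Lemma Re_add z w : Re (z + w) = Re z + Re w.
Proof. by case: z w => [? ?] [? ?]. Qed.

Lemma Im_add z w : Im (z + w) = Im z + Im w.
Proof. by case: z w => [? ?] [? ?]. Qed.

Lemma Re_opp z : Re (- z) = - Re z. Proof. by case: z. Qed.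

Lemma Re_mul z w : Re (z * w) = Re z * Re w - Im z * Im w.
Proof. by case: z w => [? ?] [? ?]. Qed.

Lemma Im_mul z w : Im (z * w) = Re z * Im w + Im z * Re w.
Proof. by case: z w => [? ?] [? ?] /=; rewrite addrC. Qed.

Lemma conj_Re z : Re z^* = Re z. Proof. by case: z. Qed.

Lemma conj_Im z : Im z^* = - Im z. Proof. by case: z. Qed.

Lemma sum_Re (I : Type) (s : seq I) (P : pred I) (F : I -> C) :
  Re (\sum_(k <- s | P k) F k) = \sum_(k <- s | P k) Re (F k).
Proof. by apply: (big_morph _ Re_add). Qed.

Lemma sum_Im (I : Type) (s : seq I) (P : pred I) (F : I -> C) :
  Im (\sum_(k <- s | P k) F k) = \sum_(k <- s | P k) Im (F k).
Proof. by apply: (big_morph _ Im_add). Qed.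

Lemma realM_Re (r : R) z : Re (r%:C%C * z) = r * Re z.
Proof. by rewrite Re_mul /= mul0r subr0. Qed.

Lemma complex_eq z w : Re z = Re w -> Im z = Im w -> z = w.
Proof. by case: z w => [? ?] [? ?] /= -> ->. Qed.

(** The order on complex numbers makes a positive radius a positive real, which
    is how epsilons in C are turned into epsilons in R. *)
Lemma gt0_complexE (e : C) : 0 < e -> exists2 r : R, 0 < r & e = r%:C%C.
Proof. by case: e => a b; rewrite ltcE /= => /andP[/eqP -> a0]; exists a. Qed.

Lemma normc_Re_le z : (`|Re z|)%:C%C <= `|z|.
Proof.
by rewrite normc_def lecR -sqrtr_sqr ler_wsqrtr// lerDl sqr_ge0.
Qed.

Lemma continuous_Re : continuous (Re : C -> R).
Proof.
move=> z; apply/(@cvgrPdist_lt _ _ C (nbhs z)) => e e0; near=> w.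
suff : (`|Re z - Re w|)%:C%C < e%:C%C :> C by rewrite ltcR.
rewrite (_ : Re z - Re w = Re (z - w)); last by rewrite Re_add Re_opp.
apply: le_lt_trans (normc_Re_le _) _; near: w.
by apply: (nbhsx_ballx z); rewrite ltcR.
Unshelve. all: by end_near. Qed.

Lemma continuous_conj : continuous (Num.conj : C -> C).
Proof.
move=> z; apply/(@cvgrPdist_lt _ _ C (nbhs z)) => e e0; near=> w.
rewrite -rmorphB norm_conjC; near: w.
exact: (nbhsx_ballx z).
Unshelve. all: by end_near. Qed.

Lemma continuous_real_complex : continuous (fun r : R => r%:C%C : C).
Proof.
move=> r; apply/(@cvgrPdist_lt C C) => e /gt0_complexE[{}e e0 ->]; near=> s.
rewrite -[X in `|X|]/((r - s) +i* (0 - 0))%C subr0.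
rewrite normc_def /= expr0n addr0 sqrtr_sqr ltcR; near: s.
exact: (nbhsx_ballx r).
Unshelve. all: by end_near. Qed.

Lemma cvg_complex (T : Type) (F : set_system T) (FF : Filter F)
    (u v : T -> R) (a b : R) :
  u @ F --> a -> v @ F --> b ->
  (fun t => (u t +i* v t)%C : C) @ F --> ((a +i* b)%C : C).
Proof.
move=> ua vb.
have -> : (fun t => (u t +i* v t)%C : C) =
    (fun t => ((u t)%:C%C : C) + ('i%C : C) * ((v t)%:C%C : C)).
  apply/funext => t.
  by apply: complex_eq; rewrite ?Re_add ?Im_add ?Re_mul ?Im_mul /=; ring.
have -> : (a +i* b)%C = (a%:C%C : C) + ('i%C : C) * (b%:C%C : C).
  by apply: complex_eq; rewrite ?Re_add ?Im_add ?Re_mul ?Im_mul /=; ring.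
apply: (@cvgD _ C).
  by apply: continuous_cvg ua; exact: continuous_real_complex.
apply: (@cvgM C); first exact: cvg_cst.
by apply: continuous_cvg vb; exact: continuous_real_complex.
Qed.

Lemma cvg_mx (T : Type) (F : set_system T) (FF : Filter F) m n
    (M : T -> 'M[C]_(m, n)) (L : 'M[C]_(m, n)) :
  (forall a b, (fun t => M t a b) @ F --> L a b) -> M @ F --> L.
Proof.
move=> cF; apply/cvg_mx_entourageP => A entA.
have : F (fun t => forall a b, A (L a b, M t a b)).
  apply: (@filter_forall _ _ (fun a t => forall b, A (L a b, M t a b))) => a.
  apply: (@filter_forall _ _ (fun b t => A (L a b, M t a b)) F FF) => b.
  exact: (proj1 (cvg_entourageP _ _) (cF a b) A entA).
by apply: (@filterS _ F FF) => t At a b; rewrite inE; exact: At.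
Qed.

Section ContinuousMatrices.
Variable T : topologicalType.

Lemma continuous_sum (I : Type) (r : seq I) (F : I -> T -> C) :
  (forall k, continuous (F k)) -> continuous (fun t => \sum_(k <- r) F k t).
Proof.
move=> cF; elim: r => [|k r IH].
  have -> : (fun t => \sum_(k <- [::]) F k t) = cst 0.
    by apply/funext => t; rewrite big_nil.
  exact: cst_continuous.
under eq_fun do rewrite big_cons.
by move=> t; exact: (cvgD (cF k t) (IH t)).
Qed.

(** Continuity is required entrywise, since it is by entries that the polynomial
    expressions below are seen to be continuous. *)
Definition mxcont m n (M : T -> 'M[C]_(m, n)) :=
  forall a b, continuous (fun t => M t a b).

Lemma mxcontM m n p (M : T -> 'M[C]_(m, n)) (N : T -> 'M[C]_(n, p)) :
  mxcont M -> mxcont N -> mxcont (fun t => M t *m N t).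
Proof.
move=> cM cN a b; under eq_fun do rewrite mxE.
apply: continuous_sum => k t; exact: (cvgM (cM a k t) (cN k b t)).
Qed.

Lemma mxcontD m n (M N : T -> 'M[C]_(m, n)) :
  mxcont M -> mxcont N -> mxcont (fun t => M t + N t).
Proof.
move=> cM cN a b; under eq_fun do rewrite mxE.
by move=> t; exact: (cvgD (cM a b t) (cN a b t)).
Qed.

Lemma mxcontN m n (M : T -> 'M[C]_(m, n)) :
  mxcont M -> mxcont (fun t => - M t).
Proof.
move=> cM a b; under eq_fun do rewrite mxE.
by move=> t; exact: (cvgN (cM a b t)).
Qed.

Lemma mxcont_conjtr m n (M : T -> 'M[C]_(m, n)) :
  mxcont M -> mxcont (fun t => (M t)^t*).
Proof.
move=> cM a b; under eq_fun do rewrite !mxE.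
by move=> t; exact: continuous_comp (cM b a t) (@continuous_conj _).
Qed.

Lemma mxcont_cst m n (A : 'M[C]_(m, n)) : mxcont (fun=> A).
Proof. by move=> *; exact: cst_continuous. Qed.

Lemma continuous_frob m n (M : T -> 'M[C]_(m, n)) :
  mxcont M -> continuous (fun t => frob (M t)).
Proof.
move=> cM t; rewrite /frob /reinner.
have ctr : continuous (fun s => \tr ((M s)^t* *m M s)).
  apply: continuous_sum => k; exact: (mxcontM (mxcont_conjtr cM) cM).
apply: (continuous_comp (continuous_comp (ctr t) (@continuous_Re _))).
exact: sqrt_continuous.
Qed.

End ContinuousMatrices.

Lemma mxcont_id n : mxcont (fun U : 'M[C]_n => U).
Proof. by move=> a b U; exact: (@coord_continuous C). Qed.

End ComplexPlane.

(** A limit along the whole sequence determines the value of a continuous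
    function at each cluster point, although the sequence itself need not
    converge. *)
Lemma cluster_seq_eq (T S : topologicalType) (u : nat -> T) (x : T)
    (phi : T -> S) (l : S) : hausdorff_space S ->
  cluster (u @ \oo) x -> {for x, continuous phi} ->
  (fun k => phi (u k)) @ \oo --> l -> phi x = l.
Proof.
move=> hS clx cphi ul; symmetry; apply: hS => A B lA xB.
have [y [Ay By]] := clx (phi @^-1` A) _ (ul _ lA) (cphi _ xB).
by exists (phi y).
Qed.

(** * Derivatives at 0 of curves of complex matrices *)

Section Curves.
Context {R : realType}.
Local Notation C := (Cplx R).
Local Notation Re := (@complex.Re R).
Local Notation Im := (@complex.Im R).

Definition cderive0 (g : R -> C) (z : C) : Prop :=
  is_derive (0 : R) (1 : R) (fun s => Re (g s)) (Re z) /\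
  is_derive (0 : R) (1 : R) (fun s => Im (g s)) (Im z).

Lemma cderive0_unique g z w : cderive0 g z -> cderive0 g w -> z = w.
Proof.
move=> [gz1 gz2] [gw1 gw2]; apply: complex_eq.
  by rewrite -(@derive_val _ _ _ _ _ _ _ gz1) -(@derive_val _ _ _ _ _ _ _ gw1).
by rewrite -(@derive_val _ _ _ _ _ _ _ gz2) -(@derive_val _ _ _ _ _ _ _ gw2).
Qed.

Lemma cderive0_cst (z : C) : cderive0 (fun=> z) 0.
Proof. by split; exact: is_derive_cst. Qed.

Lemma cderive0D g h z w :
  cderive0 g z -> cderive0 h w -> cderive0 (fun s => g s + h s) (z + w).
Proof.
move=> [g1 g2] [h1 h2]; split.
  by under eq_fun do rewrite Re_add; rewrite Re_add; exact: is_deriveD.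
by under eq_fun do rewrite Im_add; rewrite Im_add; exact: is_deriveD.
Qed.

Lemma cderive0_conj g z :
  cderive0 g z -> cderive0 (fun s => (g s)^*) z^*.
Proof.
move=> [g1 g2]; split.
  by under eq_fun do rewrite conj_Re; rewrite conj_Re.
by under eq_fun do rewrite conj_Im; rewrite conj_Im; exact: is_deriveN.
Qed.

Lemma cderive0M g h z w : cderive0 g z -> cderive0 h w ->
  cderive0 (fun s => g s * h s) (z * h 0 + g 0 * w).
Proof.
move=> [g1 g2] [h1 h2]; split.
  under eq_fun do rewrite Re_mul.
  apply: (is_derive_eq (is_deriveB (is_deriveM g1 h1) (is_deriveM g2 h2))).
  rewrite /= !Re_add !Re_mul /GRing.scale /=; ring.
under eq_fun do rewrite Im_mul.
apply: (is_derive_eq (is_deriveD (is_deriveM g1 h2) (is_deriveM g2 h1))).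
rewrite /= !Im_add !Im_mul /GRing.scale /=; ring.
Qed.

Lemma cderive0_sum (I : Type) (r : seq I) (P : pred I) (g : I -> R -> C)
    (z : I -> C) : (forall k, P k -> cderive0 (g k) (z k)) ->
  cderive0 (fun s => \sum_(k <- r | P k) g k s) (\sum_(k <- r | P k) z k).
Proof.
move=> gz; elim: r => [|k r IH].
  by rewrite big_nil; under eq_fun do rewrite big_nil; exact: cderive0_cst.
rewrite big_cons; under eq_fun do rewrite big_cons.
by case: ifP => // /gz gk; exact: cderive0D.
Qed.

(** Rectangular version of [has_velocity0], to which it unfolds on square
    matrices; the product rule below changes shapes. *)
Definition mderive0 m n (gamma : R -> 'M[C]_(m, n)) (Z : 'M[C]_(m, n)) : Prop :=
  forall a b, cderive0 (fun s => gamma s a b) (Z a b).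

Lemma mderive0_unique m n (g : R -> 'M[C]_(m, n)) Z W :
  mderive0 g Z -> mderive0 g W -> Z = W.
Proof.
by move=> gZ gW; apply/matrixP => a b; exact: cderive0_unique (gZ a b) (gW a b).
Qed.

Lemma mderive0_cst m n (A : 'M[C]_(m, n)) : mderive0 (fun=> A) 0.
Proof. by move=> a b; rewrite mxE; exact: cderive0_cst. Qed.

Lemma mderive0D m n (g h : R -> 'M[C]_(m, n)) Z W :
  mderive0 g Z -> mderive0 h W -> mderive0 (fun s => g s + h s) (Z + W).
Proof.
move=> gZ hW a b; under eq_fun do rewrite mxE.
by rewrite mxE; exact: cderive0D.
Qed.

Lemma mderive0M m n p (g : R -> 'M[C]_(m, n)) (h : R -> 'M[C]_(n, p)) Z W :
  mderive0 g Z -> mderive0 h W ->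
  mderive0 (fun s => g s *m h s) (Z *m h 0 + g 0 *m W).
Proof.
move=> gZ hW a b; under eq_fun do rewrite mxE.
rewrite !mxE -big_split /=; apply: cderive0_sum => k _; exact: cderive0M.
Qed.

Lemma mderive0_conjtr m n (g : R -> 'M[C]_(m, n)) Z :
  mderive0 g Z -> mderive0 (fun s => (g s)^t*) (Z^t*).
Proof.
move=> gZ a b; under eq_fun do rewrite !mxE.
by rewrite !mxE; exact: cderive0_conj.
Qed.

Lemma mderive0_mul_cst m n p q (A : 'M[C]_(m, n)) (B : 'M[C]_(p, q))
    (g : R -> 'M[C]_(n, p)) Z :
  mderive0 g Z -> mderive0 (fun s => A *m g s *m B) (A *m Z *m B).
Proof.
move=> gZ; have := mderive0M (mderive0M (mderive0_cst A) gZ) (mderive0_cst B).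
by rewrite mulmx0 addr0 mul0mx add0r.
Qed.

End Curves.

(** * Functions with continuous Wirtinger derivatives *)

Section Smooth.
Context {R : realType}.
Local Notation C := (Cplx R).
Variable n : nat.
Implicit Types (F G : 'M[C]_n -> C) (P Q : 'M[C]_n -> 'M[C]_n).

(** P is the transposed matrix of the derivatives of F with respect to the entries
    of U, and Q the transposed matrix of the conjugates of its derivatives with
    respect to the conjugate entries.  This representation, unlike a bare
    differential, makes real linearity in the direction Z automatic and reduces
    the continuity of the gradient to that of two matrices. *)
Definition wirtinger F P Q : Prop :=
  [/\ continuous F, mxcont P, mxcont Q &
      forall (gamma : R -> 'M[C]_n) Z, has_velocity0 gamma Z ->
        cderive0 (fun s => F (gamma s))
          (\tr (P (gamma 0) *m Z) + (\tr (Q (gamma 0) *m Z))^*)].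

Definition C1fun F := exists P Q, wirtinger F P Q.

Lemma C1fun_cst (z : C) : C1fun (fun=> z).
Proof.
exists (fun=> 0), (fun=> 0); split.
- by move=> *; exact: cst_continuous.
- exact: mxcont_cst.
- exact: mxcont_cst.
- by move=> gamma Z _; rewrite !mul0mx mxtrace0 rmorph0 addr0; exact: cderive0_cst.
Qed.

Lemma C1fun_entry (a b : 'I_n) : C1fun (fun U => U a b).
Proof.
exists (fun=> delta_mx b a), (fun=> 0); split.
- by move=> U; exact: (@coord_continuous C).
- exact: mxcont_cst.
- exact: mxcont_cst.
- move=> gamma Z gZ; rewrite mul0mx mxtrace0 rmorph0 addr0.
  have -> : \tr (delta_mx b a *m Z) = Z a b; last exact: gZ.
  rewrite /mxtrace (bigD1 b) //= big1 ?addr0 => [|c cb]; rewrite mxE.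
    rewrite (bigD1 a) //= big1 ?addr0 => [|c ca]; rewrite mxE ?eqxx ?mul1r //.
    by rewrite (negPf ca) andbF mul0r.
  by rewrite big1 // => k _; rewrite mxE (negPf cb) mul0r.
Qed.

(** Conjugating F exchanges the two kinds of derivatives, hence P and Q. *)
Lemma C1fun_conj F : C1fun F -> C1fun (fun U => (F U)^*).
Proof.
move=> [P [Q [cF cP cQ dF]]]; exists Q, P; split.
- by move=> U; exact: continuous_comp (cF U) (@continuous_conj R _).
- exact: cQ.
- exact: cP.
move=> gamma Z /dF /cderive0_conj.
by rewrite rmorphD /= conjCK addrC.
Qed.

Lemma C1funD F G : C1fun F -> C1fun G -> C1fun (fun U => F U + G U).
Proof.
move=> [P [Q [cF cP cQ dF]]] [P' [Q' [cG cP' cQ' dG]]].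
exists (fun U => P U + P' U), (fun U => Q U + Q' U); split.
- by move=> U; exact: (cvgD (cF U) (cG U)).
- exact: mxcontD cP cP'.
- exact: mxcontD cQ cQ'.
- move=> gamma Z gZ; have := cderive0D (dF _ _ gZ) (dG _ _ gZ).
  by rewrite !mulmxDl !mxtraceD rmorphD /= addrACA.
Qed.

Lemma C1funM F G : C1fun F -> C1fun G -> C1fun (fun U => F U * G U).
Proof.
move=> [P [Q [cF cP cQ dF]]] [P' [Q' [cG cP' cQ' dG]]].
exists (fun U => G U *: P U + F U *: P' U),
       (fun U => (G U)^* *: Q U + (F U)^* *: Q' U); split.
- by move=> U; exact: (cvgM (cF U) (cG U)).
- move=> a b; under eq_fun do rewrite !mxE.
  by move=> U; exact: (cvgD (cvgM (cG U) (cP a b U)) (cvgM (cF U) (cP' a b U))).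
- move=> a b; under eq_fun do rewrite !mxE.
  move=> U.
  have cF' := continuous_comp (cF U) (@continuous_conj R _).
  have cG' := continuous_comp (cG U) (@continuous_conj R _).
  exact: (cvgD (cvgM cG' (cQ a b U)) (cvgM cF' (cQ' a b U))).
- move=> gamma Z gZ; have := cderive0M (dF _ _ gZ) (dG _ _ gZ).
  congr cderive0.
  rewrite !mulmxDl -!scalemxAl !mxtraceD !mxtraceZ rmorphD /= !rmorphM /= !conjCK.
  set x := \tr _; set y := \tr _; set z := \tr _; set t := \tr _.
  ring.
Qed.

Lemma C1fun_sum (I : Type) (r : seq I) (A : pred I) (F : I -> 'M[C]_n -> C) :
  (forall k, C1fun (F k)) -> C1fun (fun U => \sum_(k <- r | A k) F k U).
Proof.
move=> cF; elim: r => [|k r IH].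
  by under eq_fun do rewrite big_nil; exact: C1fun_cst.
under eq_fun do rewrite big_cons.
by case: (A k) => //; exact: C1funD.
Qed.

End Smooth.

(** * The real inner product and the Frobenius norm *)

Section InnerProduct.
Context {R : realType}.
Local Notation C := (Cplx R).
Local Notation Re := (@complex.Re R).

Lemma conjtrM m n p (A : 'M[C]_(m, n)) (B : 'M[C]_(n, p)) :
  (A *m B)^t* = B^t* *m A^t*.
Proof. by rewrite trmx_mul map_mxM. Qed.

Lemma conjtrD m n (A B : 'M[C]_(m, n)) : (A + B)^t* = A^t* + B^t*.
Proof. by rewrite linearD map_mxD. Qed.

Lemma conjtrN m n (A : 'M[C]_(m, n)) : (- A)^t* = - A^t*.
Proof. by rewrite linearN map_mxN. Qed.

Lemma conjtrZ m n (a : C) (A : 'M[C]_(m, n)) : (a *: A)^t* = a^* *: A^t*.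
Proof. by apply/matrixP => i j; rewrite !mxE rmorphM. Qed.

Lemma Re_tr_conjtr n (A : 'M[C]_n) : Re (\tr (A^t*)) = Re (\tr A).
Proof.
rewrite -[RHS]conj_Re /mxtrace rmorph_sum; congr Re.
by apply: eq_bigr => i _; rewrite !mxE.
Qed.

Lemma reinnerC m n (X Y : 'M[C]_(m, n)) : reinner X Y = reinner Y X.
Proof. by rewrite /reinner -Re_tr_conjtr conjtrM trmxCK. Qed.

Lemma reinnerBl m n (X Y Z : 'M[C]_(m, n)) :
  reinner (X - Y) Z = reinner X Z - reinner Y Z.
Proof. by rewrite /reinner conjtrD conjtrN mulmxBl raddfB Re_add Re_opp. Qed.

Lemma reinnerZ m n (t : R) (X Y : 'M[C]_(m, n)) :
  reinner X ((t%:C)%C *: Y) = t * reinner X Y.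
Proof. by rewrite /reinner -scalemxAr mxtraceZ realM_Re. Qed.

(** Multiplications by A and by A^H are adjoint for the real inner product; with
    the variant on the right, this moves U and the coordinate inclusion of a plane
    from the direction to the gradient. *)
Lemma reinner_mull m n p (A : 'M[C]_(m, n)) (X : 'M[C]_(m, p)) (Y : 'M[C]_(n, p)) :
  reinner X (A *m Y) = reinner (A^t* *m X) Y.
Proof. by rewrite /reinner conjtrM trmxCK mulmxA. Qed.

Lemma reinner_mulr m n p (A : 'M[C]_(n, p)) (X : 'M[C]_(m, p)) (Y : 'M[C]_(m, n)) :
  reinner X (Y *m A) = reinner (X *m A^t*) Y.
Proof. by rewrite /reinner conjtrM trmxCK mulmxA mxtrace_mulC mulmxA. Qed.

Lemma reinner_sum m n (X : 'M[C]_(m, n)) :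
  reinner X X = \sum_j \sum_i (Re (X i j) ^+ 2 + complex.Im (X i j) ^+ 2).
Proof.
rewrite /reinner /mxtrace sum_Re; apply: eq_bigr => j _.
rewrite mxE sum_Re; apply: eq_bigr => i _.
by rewrite !mxE Re_mul conj_Re conj_Im; ring.
Qed.

Lemma reinner_ge0 m n (X : 'M[C]_(m, n)) : 0 <= reinner X X.
Proof.
rewrite reinner_sum; apply: sumr_ge0 => j _; apply: sumr_ge0 => i _.
by rewrite addr_ge0 ?sqr_ge0.
Qed.

Lemma reinner_eq0 m n (X : 'M[C]_(m, n)) : reinner X X = 0 -> X = 0.
Proof.
have ge0 i j : 0 <= Re (X i j) ^+ 2 + complex.Im (X i j) ^+ 2.
  by rewrite addr_ge0 ?sqr_ge0.
rewrite reinner_sum => /eqP; rewrite psumr_eq0 => [/allP X0|j _]; last first.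
  exact: sumr_ge0.
apply/matrixP => i j; rewrite mxE.
have := X0 j (mem_index_enum _); rewrite /= psumr_eq0// => /allP/(_ i (mem_index_enum _)) /=.
rewrite paddr_eq0 ?sqr_ge0// !sqrf_eq0 => /andP[/eqP r0 /eqP i0].
exact: complex_eq.
Qed.

Lemma frob_sqr m n (X : 'M[C]_(m, n)) : frob X ^+ 2 = reinner X X.
Proof. by rewrite /frob sqr_sqrtr// reinner_ge0. Qed.

Lemma frob_ge0 m n (X : 'M[C]_(m, n)) : 0 <= frob X.
Proof. exact: sqrtr_ge0. Qed.

Lemma frob_eq0 m n (X : 'M[C]_(m, n)) : frob X = 0 -> X = 0.
Proof. by move=> X0; apply: reinner_eq0; rewrite -frob_sqr X0 expr0n. Qed.

Lemma unitary_conjtrK n (U : 'M[C]_n) : U \is unitarymx -> U^t* *m U = 1%:M.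
Proof. by move=> Uu; rewrite -invmx_unitary// mulVmx// unitarymx_unit. Qed.

Lemma frob_unitary n m (U : 'M[C]_n) (X : 'M[C]_(n, m)) :
  U \is unitarymx -> frob (U *m X) = frob X.
Proof.
by move=> Uu; rewrite /frob reinner_mull (mulmxA (U^t* ) U) (unitary_conjtrK Uu) mul1mx.
Qed.

End InnerProduct.

(** * The exponential of a skew-Hermitian matrix *)

Section Exponential.
Context {R : realType}.
Local Notation C := (Cplx R).
Local Notation Re := (@complex.Re R).

Definition imag_diag m (theta : 'I_m -> R) : 'M[C]_m :=
  diag_mx (\row_l ((theta l) *i)%C).
Definition phase_diag m (theta : 'I_m -> R) : 'M[C]_m :=
  diag_mx (\row_l (cos (theta l) +i* sin (theta l))%C).

(** The parity factors are those of the cosine and sine series, so that Euler's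
    formula can be read off coefficient by coefficient. *)
Lemma imag_powE (x : R) k :
  ((x *i)%C : C) ^+ k =
  ((~~ odd k)%:R * (-1) ^+ k./2 * x ^+ k
    +i* ((odd k)%:R * (-1) ^+ k.-1./2 * x ^+ k))%C.
Proof.
have even_pow m : ((x *i)%C : C) ^+ m.*2 = (((-1) ^+ m * x ^+ m.*2) +i* 0)%C.
  elim: m => [|m IH]; first by apply: complex_eq => /=; rewrite ?expr0 ?mulr1.
  rewrite doubleS !exprS IH.
  by apply: complex_eq; rewrite !(Re_mul, Im_mul) /=; ring.
have := odd_double_half k; case: (odd k); move: k./2 => m <-.
  rewrite add1n /= doubleK !exprS even_pow.
  by apply: complex_eq; rewrite !(Re_mul, Im_mul) /=; ring.
rewrite add0n even_pow.
by apply: complex_eq => /=; rewrite ?mul0r ?mul1r.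
Qed.

Lemma exp_imag_coeffE (x : R) k :
  (k`!%:R : C)^-1 * (x *i)%C ^+ k = (cos_coeff x k +i* sin_coeff x k)%C.
Proof.
have -> : (k`!%:R : C)^-1 = ((k`!%:R : R)^-1)%:C%C.
  by rewrite -[RHS]/(real_complex R _) fmorphV rmorph_nat.
rewrite /cos_coeff /sin_coeff /= -!exprnP imag_powE.
by apply: complex_eq; rewrite !(Re_mul, Im_mul) /=; ring.
Qed.

Lemma cvg_exp_imag (x : R) :
  (fun N => \sum_(0 <= k < N) (k`!%:R : C)^-1 * (x *i)%C ^+ k) @ \oo -->
  ((cos x +i* sin x)%C : C).
Proof.
have -> : (fun N => \sum_(0 <= k < N) (k`!%:R : C)^-1 * (x *i)%C ^+ k) =
   fun N => ((series (cos_coeff x) N +i* series (sin_coeff x) N)%C : C).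
  apply/funext => N; apply: complex_eq.
    by rewrite sum_Re; apply: eq_bigr => k _; rewrite exp_imag_coeffE.
  by rewrite sum_Im; apply: eq_bigr => k _; rewrite exp_imag_coeffE.
apply: cvg_complex.
  by rewrite unlock; exact: is_cvg_series_cos_coeff.
by rewrite unlock; exact: is_cvg_series_sin_coeff.
Qed.

Lemma cvg_sumr (I : Type) (r : seq I) (f : I -> nat -> C) (l : I -> C) :
  (forall k, f k @ \oo --> l k) ->
  (fun N => \sum_(k <- r) f k N) @ \oo --> \sum_(k <- r) l k.
Proof.
move=> fl; elim: r => [|k r IH].
  by under eq_fun do rewrite big_nil; rewrite big_nil; exact: cvg_cst.
under eq_fun do rewrite big_cons.
by rewrite big_cons; exact: cvgD (fl k) IH.
Qed.

Lemma cvg_mulmx_diag n m p (A : 'M[C]_(n, p)) (V : 'M[C]_(n, m)) (W : 'M[C]_(m, p))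
    (u : nat -> 'I_m -> C) (v : 'I_m -> C) :
  (forall l, (fun N => u N l) @ \oo --> v l) ->
  (fun N => A + V *m diag_mx (\row_l u N l) *m W) @ \oo -->
  A + V *m diag_mx (\row_l v l) *m W.
Proof.
have entryE e a b : (A + V *m diag_mx (\row_l e l) *m W) a b =
    A a b + \sum_l V a l * e l * W l b.
  rewrite mxE mul_mx_diag; congr (_ + _); rewrite mxE.
  by apply: eq_bigr => l _; rewrite !mxE.
move=> uv; apply: cvg_mx => a b; under eq_fun do rewrite entryE.
rewrite entryE; apply: cvgD; first exact: cvg_cst.
apply: (@cvg_sumr _ _ (fun l N => V a l * u N l * W l b)) => l.
exact: (cvgM (cvgM (cvg_cst _) (uv l)) (cvg_cst _)).
Qed.

(** When W is an isometric embedding of C^m into C^n, the powers of order at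
    least 1 of W D W^H are W D^k W^H, whereas the power of order 0 is the identity
    of C^n and not W W^H: this explains the term 1 - W W^H, the identity on the
    complement of the image of W.  The case m = n is the exponential of a
    skew-Hermitian matrix, and the case m = 2 that of a matrix acting on a
    coordinate plane. *)
Lemma expmx_isometry n m (W : 'M[C]_(n, m)) (theta : 'I_m -> R) :
  W^t* *m W = 1%:M ->
  expmx (W *m imag_diag theta *m W^t*) =
  1%:M - W *m W^t* + W *m phase_diag theta *m W^t*.
Proof.
move=> Wiso; pose z l : C := ((theta l) *i)%C.
pose D (e : 'I_m -> C) : 'M[C]_n := W *m diag_mx (\row_l e l) *m W^t*.
have DM e e' : D e *m D e' = D (fun l => e l * e' l).
  rewrite /D !mulmxA -[X in X *m _ *m _]mulmxA Wiso mulmx1.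
  rewrite -[X in X *m _]mulmxA mulmx_diag.
  suff -> : (\row_l ((\row_l e l) 0 l * (\row_l e' l) 0 l)) = \row_l (e l * e' l) by [].
  by apply/rowP => l; rewrite !mxE.
have DD c e e' : c *: D e + D e' = D (fun l => c * e l + e' l).
  rewrite /D; have <- : c *: diag_mx (\row_l e l) + diag_mx (\row_l e' l) =
      diag_mx (\row_l (c * e l + e' l)).
    by rewrite -linearZ -linearD /=; congr diag_mx; apply/rowP => l; rewrite !mxE.
  by rewrite mulmxDr mulmxDl -scalemxAr -scalemxAl.
have powD k : D z ^+ k.+1 = D (fun l => z l ^+ k.+1).
  elim: k => [|k IH]; first by rewrite expr1.
  by rewrite exprS IH -mulmxE DM.
have partial N : series (fun k => (k`!%:R : C)^-1 *: D z ^+ k) N.+1 =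
    1%:M - W *m W^t* +
    D (fun l => \sum_(0 <= k < N.+1) (k`!%:R : C)^-1 * z l ^+ k).
  elim: N => [|N IH].
    rewrite /series /= big_nat1 fact0 invr1 scale1r expr0.
    have -> : D (fun l => \sum_(0 <= k < 1) (k`!%:R : C)^-1 * z l ^+ k) = W *m W^t*.
      rewrite /D (_ : (\row_l _) = const_mx 1) ?diag_const_mx ?mulmx1 //.
      by apply/rowP => l; rewrite !mxE big_nat1 fact0 invr1 mul1r expr0.
    by rewrite subrK.
  rewrite seriesSr IH powD -addrA; congr (_ + _).
  rewrite addrC DD; congr D; apply/funext => l.
  by rewrite [in RHS]big_nat_recr //= addrC.
(* [partial] describes only the nonempty partial sums, hence the shift *)
apply: cvg_lim; first exact: norm_hausdorff.
rewrite -cvg_shiftS; under eq_fun do rewrite /= partial.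
apply: (@cvg_mulmx_diag _ _ _ _ _ _
  (fun N l => \sum_(0 <= k < N.+1) (k`!%:R : C)^-1 * z l ^+ k)) => l.
rewrite (cvg_shiftS (fun N => \sum_(0 <= k < N) _)).
exact: cvg_exp_imag.
Qed.

(** A skew-Hermitian matrix is normal, so it is unitarily diagonalizable; its
    diagonal form is again skew-Hermitian, which forces the eigenvalues to be
    purely imaginary. *)
Lemma skew_hermitian_spectral n (Omega : 'M[C]_n) : skew_hermitian Omega ->
  exists2 V : 'M[C]_n, V \is unitarymx &
  exists theta : 'I_n -> R,
    Omega = V^t* *m imag_diag theta *m V.
Proof.
move=> sk; have OmE : Omega^t* = - Omega.
  by apply/eqP; rewrite eq_sym eqr_oppLR -addr_eq0; apply/eqP.
have /orthomx_spectralP : Omega \is normalmx.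
  by apply/normalmxP; rewrite OmE mulmxN mulNmx.
set V := spectralmx Omega; set d := spectral_diag Omega.
have Vu : V \is unitarymx by exact: spectral_unitarymx.
rewrite invmx_unitary// => Omd; exists V => //.
exists (fun l => complex.Im (d 0 l)).
have diagE : diag_mx d = V *m Omega *m V^t*.
  by rewrite Omd !mulmxA (unitarymxP Vu) mul1mx -mulmxA (unitarymxP Vu) mulmx1.
have : (diag_mx d)^t* = - diag_mx d.
  by rewrite diagE !conjtrM trmxCK OmE mulNmx mulmxN mulmxA.
move=> dE; suff -> : imag_diag (fun l => complex.Im (d 0 l)) = diag_mx d by [].
congr diag_mx; apply/rowP => l; rewrite mxE.
have := congr1 (fun M : 'M[C]_n => M l l) dE; rewrite /= !mxE eqxx !mulr1n.
move: (d 0 l) => z zE; apply: complex_eq => //=.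
have := congr1 Re zE; rewrite conj_Re Re_opp => /eqP.
by rewrite -addr_eq0 -mulr2n mulrn_eq0 => /eqP ->.
Qed.

Lemma phase_diag_unitary m (theta : 'I_m -> R) : phase_diag theta \is unitarymx.
Proof.
apply/unitarymxP; rewrite tr_diag_mx map_diag_mx mulmx_diag -diag_const_mx.
congr diag_mx; apply/rowP => l; rewrite !mxE.
have := cos2Dsin2 (theta l); set c := cos _; set s := sin _ => cs1.
apply: complex_eq; rewrite ?Re_mul ?Im_mul conj_Re conj_Im /=.
  by rewrite mulrN opprK -!expr2.
by ring.
Qed.

Lemma phase_diag0 m : phase_diag (fun _ : 'I_m => 0 : R) = 1%:M.
Proof.
rewrite -diag_const_mx; congr diag_mx; apply/rowP => l; rewrite !mxE.
by rewrite cos0 sin0.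
Qed.

Lemma phase_diag_velocity m (theta : 'I_m -> R) :
  mderive0 (fun s => phase_diag (fun l => s * theta l)) (imag_diag theta).
Proof.
move=> a b; have [<-|ab] := eqVneq a b; last first.
  under eq_fun do rewrite !mxE (negPf ab) mulr0n.
  by rewrite !mxE (negPf ab) mulr0n; exact: cderive0_cst.
under eq_fun do rewrite !mxE eqxx mulr1n.
rewrite !mxE eqxx mulr1n.
have dlin : is_derive (0 : R) (1 : R) (fun s : R => s * theta a) (theta a).
  have -> : (fun s : R => s * theta a) = (theta a \*: id).
    by apply/funext => s; rewrite /= mulrC.
  by apply: is_derive_eq; rewrite /GRing.scale /= mulr1.
split => /=.
  have dcos := @is_derive1_comp R cos (fun s => s * theta a) 0 _ _
    (is_derive_cos _) dlin.
  by apply: (is_derive_eq dcos); rewrite mul0r sin0 oppr0 mul0r.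
have dsin := @is_derive1_comp R sin (fun s => s * theta a) 0 _ _
  (is_derive_sin _) dlin.
by apply: (is_derive_eq dsin); rewrite mul0r cos0 mul1r.
Qed.

(** The curve is U V^H diag(exp(i s theta)) V, whose velocity at s = 0 is obtained
    from the derivatives of cosine and sine alone. *)
Lemma tangent_curve n (U Omega : 'M[C]_n) :
    U \is unitarymx -> skew_hermitian Omega ->
  exists gamma : R -> 'M[C]_n,
    [/\ forall s, gamma s \is unitarymx, gamma 0 = U &
        has_velocity0 gamma (U *m Omega)].
Proof.
move=> Uu /skew_hermitian_spectral [V Vu [theta ->]].
exists (fun s => U *m V^t* *m phase_diag (fun l => s * theta l) *m V); split.
- by move=> s; rewrite !mul_unitarymx ?trmxC_unitary ?phase_diag_unitary.
- have -> : phase_diag (fun l => 0 * theta l) = 1%:M :> 'M[C]_n.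
    by rewrite -phase_diag0; congr phase_diag; apply/funext => l; rewrite mul0r.
  by rewrite mulmx1 -mulmxA unitary_conjtrK// mulmx1.
- by rewrite !mulmxA; apply: mderive0_mul_cst; exact: phase_diag_velocity.
Qed.

Lemma expmx_skew_unitary n (Omega : 'M[C]_n) :
  skew_hermitian Omega -> expmx Omega \is unitarymx.
Proof.
move=> /skew_hermitian_spectral [V Vu [theta ->]].
have := @expmx_isometry n n (V^t* ) theta; rewrite trmxCK => ->; last exact/unitarymxP.
rewrite (unitary_conjtrK Vu) subrr add0r.
by rewrite !mul_unitarymx ?trmxC_unitary ?phase_diag_unitary.
Qed.

Lemma skew_hermitian_realZ m (t : R) (A : 'M[C]_m) :
  skew_hermitian A -> skew_hermitian ((t%:C)%C *: A).
Proof.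
rewrite /skew_hermitian conjtrZ => skA.
have -> : ((t%:C)%C : C)^* = (t%:C)%C by apply: complex_eq => //=; rewrite oppr0.
by rewrite -scalerDr skA scaler0.
Qed.

End Exponential.

(** * Existence, uniqueness and continuity of the Riemannian gradient *)

Section Gradient.
Context {R : realType}.
Local Notation C := (Cplx R).
Local Notation Re := (@complex.Re R).

(** Differentiating gamma gamma^H = 1 gives Z U^H + U Z^H = 0; conjugation by U
    turns this into the statement. *)
Lemma unitary_velocity n (gamma : R -> 'M[C]_n) Z :
    (forall s, gamma s \is unitarymx) -> has_velocity0 gamma Z ->
  skew_hermitian ((gamma 0)^t* *m Z).
Proof.
move=> gU gZ; have gZ' : mderive0 gamma Z by [].
have := mderive0M gZ' (mderive0_conjtr gZ').
under eq_fun do rewrite (unitarymxP (gU _)).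
move=> /mderive0_unique /(_ (mderive0_cst _)) => E0.
have g0 := gU 0; move: (gamma 0) g0 E0 => U Uu E0.
have UV := unitary_conjtrK Uu.
rewrite /skew_hermitian conjtrM trmxCK.
have := congr1 (fun M => U^t* *m M *m U) E0.
rewrite /= mulmx0 mul0mx mulmxDr mulmxDl !mulmxA UV mul1mx.
by rewrite -[_ *m U^t* *m U]mulmxA UV mulmx1.
Qed.

(** The difference of two gradients is tangent, hence the velocity of some curve of
    unitary matrices; comparing the derivatives of f along it shows that the
    difference is orthogonal to itself. *)
Lemma is_rgrad_unique n (f : 'M[C]_n -> R) (U G H : 'M[C]_n) :
  U \is unitarymx -> is_rgrad f U G -> is_rgrad f U H -> G = H.
Proof.
move=> Uu [[A skA GE] dG] [[B skB HE] dH].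
have skAB : skew_hermitian (A - B).
  by rewrite /skew_hermitian conjtrD conjtrN addrACA -opprD skA skB subrr.
have [gamma [gU g0 gZ]] := tangent_curve Uu skAB.
have := dG gamma _ gU g0 gZ; have := dH gamma _ gU g0 gZ.
rewrite mulmxBr -GE -HE => dH' dG'.
have /eqP : reinner G (G - H) = reinner H (G - H).
  by rewrite -(@derive_val _ _ _ _ _ _ _ dG') -(@derive_val _ _ _ _ _ _ _ dH').
rewrite -subr_eq0 -reinnerBl => /eqP /reinner_eq0 /eqP.
by rewrite subr_eq0 => /eqP.
Qed.

Lemma rgradE n (f : 'M[C]_n -> R) (U G : 'M[C]_n) :
  U \is unitarymx -> is_rgrad f U G -> rgrad f U = G.
Proof.
move=> Uu fG; apply: (is_rgrad_unique Uu _ fG).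
exact: (xgetPex 0 (ex_intro _ G fG)).
Qed.

(** In terms of the Wirtinger derivatives of F, the Euclidean gradient of Re F is
    E = (P + Q)^H.  The Riemannian gradient is its projection on the tangent space,
    U (U^H E - E^H U) / 2: tangent directions are U Omega with Omega
    skew-Hermitian, and these are orthogonal to the Hermitian part of U^H E. *)
Lemma rgrad_exists n (F : 'M[C]_n -> C) (f : 'M[C]_n -> R) :
    C1fun F -> (forall U, U \is unitarymx -> f U = Re (F U)) ->
  exists2 G : 'M[C]_n -> 'M[C]_n, mxcont G &
    forall U, U \is unitarymx -> is_rgrad f U (G U).
Proof.
move=> [P [Q [cF cP cQ dF]]] fE.
pose E U := (P U + Q U)^t*.
pose W U := (2^-1 : C)%:M *m (U^t* *m E U - (E U)^t* *m U).
have cE : mxcont E by exact: mxcont_conjtr (mxcontD cP cQ).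
have cid := @mxcont_id R n.
have cK : mxcont (fun U => U^t* *m E U - (E U)^t* *m U).
  exact: (mxcontD (mxcontM (mxcont_conjtr cid) cE)
                  (mxcontN (mxcontM (mxcont_conjtr cE) cid))).
exists (fun U => U *m W U) => [|U Uu].
  have chalf : mxcont (fun _ : 'M[C]_n => (2^-1 : C)%:M : 'M[C]_n).
    exact: mxcont_cst.
  have cW := mxcontM chalf cK.
  have cUW := mxcontM cid cW.
  exact: cUW.
have skW : skew_hermitian (W U).
  rewrite /skew_hermitian /W !mul_scalar_mx conjtrZ.
  have -> : (2^-1 : C)^* = 2^-1 by rewrite fmorphV rmorph_nat.
  rewrite -scalerDr conjtrD conjtrN !conjtrM !trmxCK.
  by rewrite -[X in _ + X]opprB subrr scaler0.
split; first by exists (W U).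
move=> gamma Z gU g0 gZ.
have dE : is_derive (0 : R) (1 : R) (f \o gamma) (Re (\tr (P U *m Z) + (\tr (Q U *m Z))^*)).
  have := (dF gamma Z gZ).1; rewrite g0; congr is_derive.
  by apply/funext => s /=; exact: esym (fE _ (gU s)).
apply: is_derive_eq dE _; rewrite Re_add conj_Re -Re_add -mxtraceD -mulmxDl.
have skZ : skew_hermitian (U^t* *m Z) by rewrite -g0; exact: unitary_velocity.
rewrite -[P U + Q U]trmxCK -/(E U) -/(reinner (E U) Z).
have WE : W U = (2^-1 : C)%:M *m (U^t* *m E U - (U^t* *m E U)^t*).
  by rewrite /W conjtrM trmxCK.
have ZE : Z = U *m (U^t* *m Z) by rewrite mulmxA (unitarymxP Uu) mul1mx.
rewrite ZE [LHS]reinner_mull [RHS]reinner_mull (mulmxA (U^t* ) U).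
rewrite (unitary_conjtrK Uu) mul1mx WE.
move: (U^t* *m E U) skZ => K; move: (U^t* *m Z) => Om skOm.
have OmE : Om^t* = - Om.
  by apply/eqP; rewrite -addr_eq0 addrC; apply/eqP.
have halfE : (2^-1 : C) = ((2^-1 : R)%:C)%C.
  by rewrite -[RHS]/(real_complex R _) fmorphV rmorph_nat.
rewrite mul_scalar_mx halfE reinnerC [RHS]reinnerC reinnerZ reinnerC [in RHS]reinnerC reinnerBl.
have -> : reinner (K^t*) Om = - reinner K Om.
  rewrite /reinner trmxCK -Re_tr_conjtr conjtrM OmE mulNmx raddfN Re_opp.
  by rewrite mxtrace_mulC.
by rewrite opprK; field.
Qed.

End Gradient.

(** * The cost functions are real parts of smooth functions *)

Section Costs.
Context {R : realType}.
Local Notation C := (Cplx R).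
Local Notation Re := (@complex.Re R).
Variable n : nat.

(** Successive contractions interleave U with intermediate tensors that already
    depend on U; the induction therefore runs over tensor-valued functions of U. *)
Lemma C1fun_contract_all d (A : tensor n d) (M : 'I_d -> 'M[C]_n -> 'M[C]_n) :
    (forall k a b, C1fun (fun U => M k U a b)) ->
  forall i, C1fun (fun U => contract_all A (fun k => M k U) i).
Proof.
move=> cM; rewrite /contract_all.
suff : forall (s : seq 'I_d) (B : 'M[C]_n -> tensor n d),
    (forall i, C1fun (fun U => B U i)) ->
    forall i, C1fun (fun U => foldl (fun B k => Defs.contract B k (M k U)) (B U) s i).
  by apply => i; exact: C1fun_cst.
elim=> //= k s IH B cB; apply: (IH (fun U => Defs.contract (B U) k (M k U))) => i.
by apply: C1fun_sum => j; exact: C1funM.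
Qed.

Lemma C1fun_rotate d (A : tensor n d) t i :
  C1fun (fun U : 'M[C]_n => rotate_tensor A t U i).
Proof.
apply: (@C1fun_contract_all _ _ (fun k U => if (k < t)%N then U^t* else U^T)).
move=> k a b; case: (k < t)%N.
  have := C1fun_conj (C1fun_entry b a : C1fun (fun U : 'M[C]_n => U b a)).
  by congr C1fun; apply/funext => U; rewrite !mxE.
have := C1fun_entry b a : C1fun (fun U : 'M[C]_n => U b a).
by congr C1fun; apply/funext => U; rewrite !mxE.
Qed.

(** The entries of the rotated tensors are polynomials in the entries of U and
    their conjugates.  The squared modulus |z|^2 is entered as z^* z, which is
    smooth in this sense although the norm itself is not. *)
Lemma cost_C1fun (f : 'M[C]_n -> R) : cost_I f \/ cost_II f ->
  exists2 F : 'M[C]_n -> C, C1fun F & forall U, U \is unitarymx -> f U = Re (F U).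
Proof.
case=> [[p [d [t [alpha [A [_ fE]]]]]]|[d [B [_ fE]]]]; last first.
  exists (fun U => tensor_tr (rotate_tensor B d U)) => [|U Uu].
    by apply: C1fun_sum => i; exact: C1fun_rotate.
  by rewrite -(fE _ Uu).
pose diagE l (U : 'M[C]_n) i : C := rotate_tensor (A l) (t l) U [tuple i | _ < d l].
exists (fun U => \sum_(l < p) (alpha l)%:C%C *
    \sum_(i < n) (diagE l U i)^* * diagE l U i) => [|U Uu].
  apply: C1fun_sum => l; apply: C1funM; first exact: C1fun_cst.
  apply: C1fun_sum => i; apply: C1funM; last exact: C1fun_rotate.
  exact: C1fun_conj (C1fun_rotate _ _ _).
rewrite fE// sum_Re; apply: eq_bigr => l _.
rewrite realM_Re frob_sqr /reinner /mxtrace big_ord1 mxE; congr (_ * Re _).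
by apply: eq_bigr => i _; rewrite !mxE.
Qed.

End Costs.

(** * Plane transformations *)

Section Plane.
Context {R : realType}.
Local Notation C := (Cplx R).
Local Notation Re := (@complex.Re R).
Variables (n : nat) (i j : 'I_n).

(** The inclusion of C^2 as the coordinate plane (i, j) of C^n.  With it, plane
    transformations, blocks and block embeddings become matrix products, and
    entrywise case analyses are confined to [plane_injK] and [planeE]. *)
Definition plane_inj : 'M[C]_(n, 2) :=
  \matrix_(a, b) (a == if b == 0 then i else j)%:R.
Local Notation S := plane_inj.

Hypothesis ij : i != j.

Lemma plane_injK : S^t* *m S = 1%:M.
Proof.
apply/matrixP => a b; rewrite mxE.
transitivity (\sum_c ((c == if a == 0 then i else j) && (c == if b == 0 then i else j))%:R : C).
  by apply: eq_bigr => c _; rewrite !mxE conjC_nat -natrM mulnb.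
rewrite (bigD1 (if a == 0 then i else j)) //= eqxx big1 ?addr0 => [|c /negPf->] //.
rewrite mxE; congr (nat_of_bool _)%:R.
have ji : (j == i) = false by rewrite eq_sym; apply/negbTE.
have I2 (c : 'I_2) : c = 0 \/ c = 1.
  by case: c => [[|[|//]] ?]; [left|right]; exact/val_inj.
by case: (I2 a) => ->; case: (I2 b) => ->; rewrite /= ?eqxx ?(negPf ij) ?ji.
Qed.

Lemma planeE (Psi : 'M[C]_2) :
  plane i j Psi = 1%:M - S *m S^t* + S *m Psi *m S^t*.
Proof.
have ji : (j == i) = false by rewrite eq_sym; apply/negbTE.
apply/matrixP => a b.
have I2 (F : 'I_2 -> C) : \sum_k F k = F 0 + F 1.
  rewrite !big_ord_recl big_ord0 addr0; congr (F _ + F _); exact/val_inj.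
rewrite !mxE !I2 !mxE !I2 !mxE /= !conjC_nat.
have [ai|ai] := eqVneq a i; [subst a|have [aj|aj] := eqVneq a j; [subst a|]];
  (have [bi|bi] := eqVneq b i; [subst b|have [bj|bj] := eqVneq b j; [subst b|]]);
  rewrite ?(negPf ij) ?ji ?eqxx ?(negPf ai) ?(negPf bi) ?(negPf aj) ?(negPf bj) /=; try ring.
Qed.

(** Q = 1 - S S^H projects onto the complement of the plane and annihilates S, so
    Q and S Psi S^H multiply independently. *)
Lemma plane_unitary (Psi : 'M[C]_2) :
  Psi \is unitarymx -> plane i j Psi \is unitarymx.
Proof.
move=> /unitarymxP Pu; apply/unitarymxP; rewrite planeE.
set T := S^t*; have TS : T *m S = 1%:M := plane_injK.
have Tt : T^t* = S by rewrite trmxCK.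
have : (1%:M - S *m T)^t* = 1%:M - S *m T.
  by rewrite conjtrD conjtrN conjtrM Tt trmx1 map_mx1.
have : (1%:M - S *m T) *m S = 0.
  by rewrite mulmxBl mul1mx -mulmxA TS mulmx1 subrr.
have : T *m (1%:M - S *m T) = 0.
  by rewrite mulmxBr mulmx1 mulmxA TS mul1mx subrr.
have : 1%:M - S *m T + S *m T = 1%:M by rewrite subrK.
move: (1%:M - S *m T) => Q QE TQ QS Qt.
have QQ : Q *m Q = Q.
  by rewrite -[RHS]mulmx1 -QE mulmxDr mulmxA QS mul0mx addr0.
rewrite conjtrD !conjtrM Tt Qt mulmxDl !mulmxDr QQ.
rewrite (mulmxA Q) QS mul0mx addr0 -!mulmxA TQ !mulmx0 add0r.
by rewrite (mulmxA T) TS mul1mx (mulmxA Psi) Pu mul1mx.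
Qed.

(** A curve gamma in the 2 x 2 unitary group through 1 with velocity Z induces the
    curve U G(gamma), whose velocity is U S Z S^H; by adjunction, pairing it with
    grad f(U) amounts to pairing Z with the (i, j) block of U^H grad f(U). *)
Lemma plane_cost_rgrad (f : 'M[C]_n -> R) (U G : 'M[C]_n) :
  U \is unitarymx -> is_rgrad f U G ->
  is_rgrad (plane_cost f i j U) 1%:M (S^t* *m (U^t* *m G) *m S).
Proof.
move=> Uu [[Om skOm GE] dG]; split.
  exists (S^t* *m (U^t* *m G) *m S); last by rewrite mul1mx.
  rewrite GE (mulmxA (U^t* ) U) (unitary_conjtrK Uu) mul1mx /skew_hermitian !conjtrM trmxCK.
  by rewrite mulmxA -mulmxDl -mulmxDr skOm mulmx0 mul0mx.
move=> gamma Z gu g0 gZ.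
have gZ' : mderive0 gamma Z by [].
pose delta s := U *m plane i j (gamma s).
have du s : delta s \is unitarymx.
  exact: mul_unitarymx Uu (plane_unitary (gu s)).
have d0 : delta 0 = U.
  by rewrite /delta g0 planeE mulmx1 subrK mulmx1.
have dZ : has_velocity0 delta (U *m (S *m Z *m S^t* )).
  have := mderive0D (mderive0_cst (U *m (1%:M - S *m S^t* )))
                    (mderive0_mul_cst (U *m S) (S^t* ) gZ').
  rewrite add0r !mulmxA; congr mderive0; apply/funext => s.
  by rewrite /delta planeE [in RHS]mulmxDr !mulmxA.
have := dG delta _ du d0 dZ.
congr is_derive; rewrite reinner_mull reinner_mulr reinner_mull trmxCK.
by rewrite mulmxA.
Qed.

Lemma expmx_plane (A : 'M[C]_2) : skew_hermitian A ->
  expmx (S *m A *m S^t* ) = plane i j (expmx A).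
Proof.
move=> /skew_hermitian_spectral[V Vu [theta ->]].
have VV := unitarymxP Vu; have Vt := unitary_conjtrK Vu.
have := @expmx_isometry R 2 2 (V^t* ) theta; rewrite trmxCK => -> //.
rewrite Vt subrr add0r planeE.
have := @expmx_isometry R n 2 (S *m V^t* ) theta; rewrite conjtrM trmxCK.
have -> : V *m S^t* *m (S *m V^t* ) = 1%:M.
  by rewrite -mulmxA (mulmxA (S^t* ) S) plane_injK mul1mx.
have -> : S *m V^t* *m (V *m S^t* ) = S *m S^t*.
  by rewrite -mulmxA (mulmxA (V^t* ) V) Vt mul1mx.
have assoc X : S *m V^t* *m X *m (V *m S^t* ) = S *m (V^t* *m X *m V) *m S^t*.
  by rewrite !mulmxA.
by rewrite !assoc => /(_ erefl).
Qed.

End Plane.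

(** * The increase of the cost in one step *)

Section Ascent.
Context {R : realType}.
Local Notation C := (Cplx R).
Variables (n : nat) (f : 'M[C]_n -> R).

(** The number a is the squared norm of the gradient H of the plane cost, and V is
    compared with the point reached by exponentiating t H.  The bound is kept for
    all t, since the best choice t = 1 / L is not available when L = 0. *)
Lemma jacobi_step_gain (L delta : R) (U V : 'M[C]_n) :
    (forall U, U \is unitarymx -> is_rgrad f U (rgrad f U)) ->
    (forall U Omega : 'M[C]_n, U \is unitarymx -> skew_hermitian Omega ->
      `|f (U *m expmx Omega) - f U - reinner (U *m Omega) (rgrad f U)|
        <= L / 2 * frob (U *m Omega) ^+ 2) ->
    0 <= delta -> U \is unitarymx -> jacobi_step f delta U V ->
  V \is unitarymx /\ exists2 a : R, delta ^+ 2 * frob (rgrad f U) ^+ 2 <= a &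
    forall t : R, t * a - L / 2 * (t ^+ 2 * a) <= f V - f U.
Proof.
move=> fG fL d0 Uu [i [j [Psi [ltij gradh Pu Pmax ->]]]].
have ij : i != j by rewrite neq_ltn ltij.
split; first exact: mul_unitarymx Uu (plane_unitary ij Pu).
have id_u : (1%:M : 'M[C]_2) \is unitarymx.
  by apply/unitarymxP; rewrite trmx1 map_mx1 mulmx1.
have hG := plane_cost_rgrad ij Uu (fG U Uu).
move: gradh; rewrite (rgradE id_u hG).
have [[H' skH HE] _] := hG; move: HE; rewrite mul1mx => HE.
set H := _ *m _ *m _ in HE *.
rewrite -HE in skH => gradh.
exists (reinner H H).
  by rewrite -frob_sqr -exprMn ler_sqr ?nnegrE ?mulr_ge0 ?frob_ge0.
move=> s; pose S := @plane_inj R n i j.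
have SS : S^t* *m S = 1%:M := plane_injK ij.
have skA := skew_hermitian_realZ s skH.
pose A : 'M[C]_2 := (s%:C)%C *: H.
have AE : S *m A *m S^t* = (s%:C)%C *: (S *m H *m S^t* ).
  by rewrite -scalemxAr -scalemxAl.
have skE : skew_hermitian (S *m A *m S^t* ).
  by rewrite /skew_hermitian !conjtrM trmxCK mulmxA -mulmxDl -mulmxDr skA mulmx0 mul0mx.
have := fL U _ Uu skE; rewrite (expmx_plane ij skA).
rewrite frob_unitary// AE -scalemxAr reinnerC reinnerZ frob_sqr reinnerZ.
rewrite (reinnerC (_ *: _)) reinnerZ.
have -> : reinner (rgrad f U) (U *m (S *m H *m S^t* )) = reinner H H.
  by rewrite reinner_mull (reinner_mulr (S^t* )) reinner_mull trmxCK mulmxA.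
have -> : reinner (S *m H *m S^t* ) (S *m H *m S^t* ) = reinner H H.
  rewrite (reinner_mulr (S^t* )) trmxCK -(mulmxA _ (S^t* ) S) SS mulmx1.
  by rewrite reinner_mull (mulmxA (S^t* ) S) SS mul1mx.
have := Pmax _ (expmx_skew_unitary skA); rewrite /plane_cost.
set x := f _; set y := f _; set z := f U; set a := reinner _ _.
move=> xy; rewrite ler_norml => /andP[+ _]; lra.
Qed.

End Ascent.

(** * Sequences with summable squares, and convergence of the algorithm *)

Section RealSequences.
Variable R : realType.

(** For L > 0 the best t is 1 / L.  For L = 0 the left-hand side is linear in t and
    bounded above, which is impossible unless a <= 0. *)
Lemma quadratic_gain (L a D : R) : 0 <= L ->
  (forall t, t * a - L / 2 * (t ^+ 2 * a) <= D) -> a <= 2 * L * D.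
Proof.
rewrite le_eqVlt => /predU1P[<- gain|L0 gain].
  rewrite mulr0 mul0r leNgt; apply/negP => a0.
  (* this t makes the gain equal to D + 1 *)
  have := gain ((D + 1) / a); rewrite mulfVK ?gt_eqF// !mul0r subr0.
  by rewrite gerDl ler10.
have := gain L^-1.
have -> : L^-1 * a - L / 2 * (L^-1 ^+ 2 * a) = a / (2 * L).
  by field; rewrite gt_eqF.
by rewrite ler_pdivrMr ?mulr_gt0// mulrC.
Qed.

Variables (g : nat -> R) (B : R).
Hypothesis sumB : forall K, \sum_(0 <= k < K) g k ^+ 2 <= B.

Lemma cvg0_of_bounded_sum_sqr : (forall k, 0 <= g k) -> g @ \oo --> (0 : R).
Proof.
move=> g0; have sq0 : (fun k => g k ^+ 2) @ \oo --> (0 : R).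
  apply: cvg_series_cvg_0; apply: nondecreasing_is_cvgn.
    by apply: nondecreasing_series => k _ _; exact: sqr_ge0.
  by exists B => _ [K _ <-]; exact: sumB.
have -> : g = Num.sqrt \o (fun k => g k ^+ 2).
  by apply/funext => k /=; rewrite sqrtr_sqr ger0_norm.
rewrite -(sqrtr0 R).
exact: continuous_cvg (@sqrt_continuous R 0) sq0.
Qed.

(** Otherwise the terms of index 0 to N = ceil(B / eps^2), which are N + 1 in
    number, all exceed eps, and N + 1 <= B / eps^2 <= N. *)
Lemma exists_small_of_bounded_sum_sqr (eps : R) : 0 < eps ->
  exists k : nat, k%:Z <= Num.ceil (B * (1 / eps ^+ 2)) /\ g k <= eps.
Proof.
move=> e0; set M := B * _; have e2 : 0 < eps ^+ 2 by rewrite exprn_gt0.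
have B0 : 0 <= B by have := sumB 0; rewrite big_geq.
have M0 : 0 <= M by rewrite mulr_ge0// divr_ge0// ltW.
have [N NE] : exists N : nat, Num.ceil M = N%:Z.
  have : 0 <= Num.ceil M by rewrite ceil_ge0 (lt_le_trans _ M0)// ltrN10.
  by case: (Num.ceil M) => // N _; exists N.
apply: contrapT => noneg.
have big k : (k < N.+1)%N -> eps ^+ 2 <= g k ^+ 2.
  move=> kN; rewrite ler_sqr ?nnegrE; last 2 first.
  - exact: ltW.
  - rewrite ltW// ltNge; apply/negP => ge; apply: noneg; exists k.
    by rewrite NE lez_nat; split=> //; exact: le_trans ge (ltW e0).
  rewrite leNgt; apply/negP => /ltW ge; apply: noneg; exists k.
  by rewrite NE lez_nat.
have : N.+1%:R * eps ^+ 2 <= B.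
  apply: le_trans (sumB N.+1); rewrite mulr_natl -[X in _ *+ X]subn0 -sumr_const_nat.
  by rewrite !big_mkord; apply: ler_sum => k _; exact: big.
rewrite -ler_pdivlMr// => NB.
have : M <= N%:R by have := ceil_ge M; rewrite NE.
by rewrite /M div1r => /(le_trans NB); rewrite ler_nat ltnn.
Qed.

End RealSequences.

Lemma unitary_cluster (R : realType) n (U : nat -> 'M[Cplx R]_n) V :
  (forall k, U k \is unitarymx) -> cluster (U @ \oo) V -> V \is unitarymx.
Proof.
move=> Uu clV; apply/unitarymxP/matrixP => a b.
have cont := mxcontM (@mxcont_id R n) (mxcont_conjtr (@mxcont_id R n)).
apply: (cluster_seq_eq _ clV (cont a b V)); first exact: norm_hausdorff.
have -> : (fun k => (U k *m (U k)^t* ) a b) = cst ((1%:M : 'M[Cplx R]_n) a b).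
  by apply/funext => k; rewrite (unitarymxP (Uu k)).
exact: cvg_cst.
Qed.

Theorem proposition5p5 (R : realType) (n : nat) (hn : (2 <= n)%N)
    (f : 'M[Cplx R]_n -> R) (hf : cost_I f \/ cost_II f)
    (L : R) (hL0 : 0 <= L)
    (hL : forall U Omega : 'M[Cplx R]_n,
        U \is unitarymx -> skew_hermitian Omega ->
        `|f (U *m expmx Omega) - f U - reinner (U *m Omega) (rgrad f U)|
          <= L / 2 * frob (U *m Omega) ^+ 2)
    (fstar : R) (hfstar : is_max_unitary f fstar)
    (delta : R) (hdelta : 0 < delta <= Num.sqrt 2 / n%:R)
    (U : nat -> 'M[Cplx R]_n) (hU : jacobi_G f delta U) :
  [/\ (fun k => frob (rgrad f (U k))) @ \oo --> (0 : R),
      (forall V : 'M[Cplx R]_n, cluster (U @ \oo) V -> stationary f V)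
    & forall eps : R, 0 < eps ->
        exists k : nat,
          (k%:Z <= Num.ceil (2 * L * (fstar - f (U 0%N)) / delta ^+ 2
                               * (1 / eps ^+ 2)))%R
          /\ frob (rgrad f (U k)) <= eps].
Proof.
have [F cF fE] := cost_C1fun hf; have [G cG fG] := rgrad_exists cF fE.
have rE W : W \is unitarymx -> rgrad f W = G W.
  by move=> Wu; exact: rgradE Wu (fG W Wu).
have frE W : W \is unitarymx -> is_rgrad f W (rgrad f W).
  by move=> Wu; rewrite rE//; exact: fG.
have /andP[d0 _] := hdelta; have [U0 Ustep] := hU; have [_ fmax] := hfstar.
have gain k : U k \is unitarymx -> U k.+1 \is unitarymx /\
    frob (rgrad f (U k)) ^+ 2 <= 2 * L * (f (U k.+1) - f (U k)) / delta ^+ 2.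
  move=> Uk; have [Uk1 [a ga aD]] := jacobi_step_gain frE hL (ltW d0) Uk (Ustep k).
  split=> //; rewrite ler_pdivlMr ?exprn_gt0// mulrC.
  exact: le_trans ga (quadratic_gain hL0 aD).
have Uu k : U k \is unitarymx.
  by elim: k => [|k IH]; [exact: U0|exact: (gain k IH).1].
pose g k := frob (rgrad f (U k)).
have sumB K : \sum_(0 <= k < K) g k ^+ 2 <=
    2 * L * (fstar - f (U 0%N)) / delta ^+ 2.
  apply: (@le_trans _ _ (\sum_(0 <= k < K)
      2 * L * (f (U k.+1) - f (U k)) / delta ^+ 2)).
    by apply: ler_sum => k _; exact: (gain k (Uu k)).2.
  rewrite -mulr_suml -mulr_sumr telescope_sumr//.
  rewrite ler_wpM2r ?invr_ge0 ?sqr_ge0// ler_wpM2l ?mulr_ge0//.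
  by rewrite lerD2r; exact: fmax (Uu K).
have g0 : g @ \oo --> (0 : R).
  by apply: cvg0_of_bounded_sum_sqr sumB _ => k; exact: frob_ge0.
split; [exact: g0|move=> V clV|]; last exact: exists_small_of_bounded_sum_sqr sumB.
have Vu := unitary_cluster Uu clV; split=> //; apply: frob_eq0; rewrite rE//.
apply: (cluster_seq_eq _ clV (continuous_frob cG (x := V))).
  exact: norm_hausdorff.
have -> : (fun k => frob (G (U k))) = g.
  by apply/funext => k; rewrite /g (rE _ (Uu k)).
exact: g0.
Qed.
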